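(* Let $(\mathfrak{A},* )$ be a polarizable $*$-algebra, let $\mathsf{X}$ be a left $\mathfrak{A}$-module, and let $q:\mathsf{X}\to\mathfrak{A}$ be a quadrance on $\mathsf{X}$. Then there is a Hermitian form $Q$ on $\mathsf{X}$ such that $q(x)=Q(x,x)$ for all $x\in\mathsf{X}$ if and only if $q$ satisfies $$q(x+y)+q(x-y)=2(q(x)+q(y))\qquad\text{for all }x,y\in\mathsf{X}.$$ If such a form $Q$ exists, then it is unique.
   Context: A $*$-algebra $(\mathfrak{A},* )$ is a finite-dimensional unital associative algebra over $\mathbb{R}$ equipped with an $\mathbb{R}$-linear map (involution) $\alpha\mapsto\alpha^*$ satisfying $(\alpha\beta)^*=\beta^*\alpha^*$ and $(\alpha^* )^*=\alpha$. It carries its natural topology as a finite-dimensional real vector space. Its unitary group is $\Gamma(\mathfrak{A},* )=\{u\in\mathfrak{A}: uu^*=1_{\mathfrak{A}}\}$. $(\mathfrak{A},* )$ is polarizable if $\Gamma(\mathfrak{A},* )$ is compact and generates $\mathfrak{A}$, i.e. $\mathfrak{A}$ is the smallest $*$-subalgebra containing $\Gamma(\mathfrak{A},* )$ (equivalently, $\mathrm{span}_{\mathbb{R}}\Gamma(\mathfrak{A},* )=\mathfrak{A}$). A Hermitian form on a left $\mathfrak{A}$-module $\mathsf{X}$ is a map $Q:\mathsf{X}\times\mathsf{X}\to\mathfrak{A}$ with $Q(x+y,z)=Q(x,z)+Q(y,z)$, $Q(\alpha x,y)=\alpha Q(x,y)$ and $Q(x,y)^*=Q(y,x)$ for all $x,y,z\in\mathsf{X}$,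 $\alpha\in\mathfrak{A}$. A quadrance on $\mathsf{X}$ is a map $q:\mathsf{X}\to\mathfrak{A}$ such that (1) $q(x)=q(x)^*$ for all $x\in\mathsf{X}$; (2) $q(\alpha x)=\alpha q(x)\alpha^*$ for all $x\in\mathsf{X}$, $\alpha\in\mathfrak{A}$; (3) for all $x,y\in\mathsf{X}$ the map $\mathbb{R}\times\mathfrak{A}\to\mathfrak{A}$, $(\lambda,\alpha)\mapsto q(\lambda x+\alpha y)$, is continuous. No topology is assumed on $\mathsf{X}$. *)

(* Defs.v *)
From HB Require Import structures.
From mathcomp Require Import all_boot all_order all_algebra all_field.
From mathcomp Require Import all_classical all_reals all_analysis.

Set Implicit Arguments.
Unset Strict Implicit.
Unset Printing Implicit Defensive.

Import Order.TTheory GRing.Theory Num.Theory.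
Import numFieldNormedType.Exports.

Local Open Scope classical_set_scope.
Local Open Scope ring_scope.

Definition coordinates (R : realType) (V : vectType R) (v : V) :
  'rV[R]_(\dim {:V}) := \row_i coord (vbasis {:V}) i v.

(* V with its natural topology, transported from R^n along a linear
   isomorphism; all choices of basis give the same topology. *)
Definition natural (R : realType) (V : vectType R) : Type :=
  initial_topology (@coordinates R V).

HB.instance Definition _ (R : realType) (V : vectType R) :=
  Topological.on (natural V).

Section StarAlgebra.
Variables (R : realType) (A : falgType R) (star : {linear A -> A}).

Definition star_involution : Prop :=
  (forall a b : A, star (a * b) = star b * star a) /\
  (forall a : A, star (star a) = a).

Definition unitary_group : set A := [set u : A | u * star u = 1].

Definition star_subalgebra (S : {pred A}) : Prop :=
  subalg_closed S /\ {in S, forall a, star a \in S}.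

Definition star_generates (G : set A) : Prop :=
  forall S : {pred A}, star_subalgebra S ->
    (forall a, G a -> a \in S) -> forall a, a \in S.

Definition polarizable : Prop :=
  compact (unitary_group : set (natural A)) /\ star_generates unitary_group.

Variable X : lmodType A.

Definition hermitian_form (Q : X -> X -> A) : Prop :=
  [/\ forall x y z, Q (x + y) z = Q x z + Q y z,
      forall (a : A) x y, Q (a *: x) y = a * Q x y &
      forall x y, star (Q x y) = Q y x].

(* A real scalar l acts on the A-module X through l%:A = l *: 1. *)
Definition quadrance (q : X -> A) : Prop :=
  [/\ forall x, q x = star (q x),
      forall (a : A) x, q (a *: x) = a * q x * star a &
      forall x y, continuous
        (fun la : R * natural A =>
           q (la.1%:A *: x + (la.2 : A) *: y) : natural A)].

End StarAlgebra.

(* Main.v *)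
Require Import Defs.
From HB Require Import structures.
From mathcomp Require Import all_boot all_order all_algebra all_field.
From mathcomp Require Import all_classical all_reals all_analysis.
From mathcomp Require Import ring lra.
Import Order.TTheory GRing.Theory Num.Theory.
Import numFieldNormedType.Exports.
Local Open Scope classical_set_scope.
Local Open Scope ring_scope.

Set Implicit Arguments.
Unset Strict Implicit.
Unset Printing Implicit Defensive.

(** Write H(x,y) = q(x+y) - q(x) - q(y).  If q comes from a Hermitian form Q,
    then H(x,y) = Q(x,y) + Q(x,y)^*, so that for all a in the algebra
<<
      H(ax, y) = a Q(x,y) + Q(x,y)^* a^* .                              (1)
>>
    The theorem holds because (1), with x and y fixed, has exactly one solution
    Q(x,y).  Uniqueness in (1) gives the uniqueness of the form, and also its
    additivity, its linearity and its symmetry, since both sides of each of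
    these identities solve the same instance of (1).

    The analysis is confined to two places.  Continuity of q makes H bilinear
    over the reals ([polar_real]); the parallelogram law alone only gives
    additivity.  Compactness of the unitary group gives a Euclidean structure
    on the algebra for which left multiplication by a^* is adjoint to left
    multiplication by a ([exists_star_product]): a bounded group of matrices
    preserves a positive definite form, found as the unique minimiser of an
    invariant strictly convex functional ([bounded_group_fixed_point]), and
    invariance under unitaries passes to all elements because the unitaries
    generate.  Consequently <a,b> = tr(L_{a b^*}), where L is the left regular
    representation, is a positive definite form.  Right multiplications and
    the involution also behave well for it, and its orthonormal bases e satisfy
    sum e_i e_i^* = 1 ([exists_trace_frame]).

    The rest is algebra with the tensor sum e_i (x) e_i^*, which does the work
    of the average of u (x) u^* over the unitary group.  An adjoint pair of
    operators can be moved from one leg of it to the other ([frame_adjoint]).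
    Let tau a = sum e_i^* a e_i^*.

    - Uniqueness in (1): if a D + D^* a^* = 0 for all a, then D^* = -D, and
      a = D yields D D = 0, hence |D|^2 = <1, D^* D> = 0 ([re_scale_inj]).

    - Existence in (1): put h(a) = H(ax, y).  Polarising the identity
      q(ax) = a q(x) a^* in a and contracting with the tensor gives
      h(a) + tau h(a) = a K + K^* a^* with K = sum e_i h(e_i^* ).  The linear
      map a |-> a + tau a^* is injective, since
      sum |e_i a + a^* e_i^*|^2 = 2 <a, a + tau a^*>; so it is onto, and
      K = Q + tau Q^* for some Q.  Then M = h(a) - a Q - Q^* a^* is
      self-adjoint with M + tau M = 0, whence M = 0 ([re_scale_exists]). *)

(** * Fixed points and invariant forms of bounded matrix groups *)

Lemma linear_rV_continuous (R : realType) (N : nat)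
  (f : {linear 'rV[R]_N -> R^o}) : continuous (f : 'rV[R]_N -> R).
Proof.
have -> : (f : 'rV[R]_N -> R) =
    fun x => \sum_i x ord0 i * f (delta_mx ord0 i).
  apply/funext => x; rewrite {1}(row_sum_delta x) linear_sum.
  by apply: eq_bigr => i _; rewrite linearZ.
apply: (continuous_big add_continuous) => i _ x.
apply: (@cvgM R _ (nbhs x) _ (fun x : 'rV[R]_N => x ord0 i)
  (fun=> f (delta_mx ord0 i)) _ _).
  exact: coord_continuous.
exact: cvg_cst.
Qed.

Section MatrixNorm.
Variables (R : realType) (m n : nat).

Lemma entry_le_mx_norm (x : 'M[R]_(m, n)) i j : `|x i j| <= `|x|.
Proof.
rewrite [leRHS]/Num.norm/= mx_normrE.
by apply/bigmax_geP; right; exists (i, j).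
Qed.

Lemma mx_norm_le (x : 'M[R]_(m, n)) (M : R) : 0 <= M ->
  (forall i j, `|x i j| <= M) -> `|x| <= M.
Proof.
move=> M0 xM; rewrite [leLHS]/Num.norm/= mx_normrE.
by apply/bigmax_leP; split => // -[i j] _; exact: xM.
Qed.
End MatrixNorm.

Section Sqnorm.
Variable R : realType.

Definition sqnorm (n : nat) (x : 'rV[R]_n) : R := \sum_i x ord0 i ^+ 2.

Lemma sqnorm_ge0 n (x : 'rV[R]_n) : 0 <= sqnorm x.
Proof. by apply: sumr_ge0 => i _; exact: sqr_ge0. Qed.

Lemma sqnorm_eq0 n (x : 'rV[R]_n) : sqnorm x <= 0 -> x = 0.
Proof.
move=> x0; have : sqnorm x == 0 by rewrite eq_le x0 sqnorm_ge0.
rewrite psumr_eq0; last by move=> i _; exact: sqr_ge0.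
move=> /allP xi; apply/rowP => i; apply/eqP.
by have /implyP/(_ isT) := xi i (mem_index_enum i); rewrite sqrf_eq0 mxE.
Qed.

Lemma sqnormE n (x : 'rV[R]_n) : sqnorm x = (x *m x^T) ord0 ord0.
Proof. by rewrite mxE; apply: eq_bigr => i _; rewrite mxE expr2. Qed.

Lemma sqnorm_mid n (x y : 'rV[R]_n) :
  sqnorm (2^-1 *: (x + y)) =
  2^-1 * (sqnorm x + sqnorm y) - 4^-1 * sqnorm (x - y).
Proof.
rewrite /sqnorm -big_split/= !mulr_sumr -sumrB; apply: eq_bigr => i _.
by rewrite !mxE; field.
Qed.

Lemma sqr_sum_le (n : nat) (a : 'I_n -> R) :
  (\sum_i a i) ^+ 2 <= n%:R * \sum_i a i ^+ 2.
Proof.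
have : 0 <= \sum_i \sum_j (a i - a j) ^+ 2.
  by apply: sumr_ge0 => i _; apply: sumr_ge0 => j _; exact: sqr_ge0.
suff -> : \sum_i \sum_j (a i - a j) ^+ 2 =
   2 * (n%:R * (\sum_i a i ^+ 2) - (\sum_i a i) ^+ 2).
  by rewrite pmulr_rge0// subr_ge0.
have -> : \sum_i \sum_j (a i - a j) ^+ 2 =
    \sum_i \sum_j (a i ^+ 2 + a j ^+ 2 - 2 * (a i * a j)).
  by apply: eq_bigr => i _; apply: eq_bigr => j _; ring.
transitivity (\sum_i (n%:R * a i ^+ 2 + \sum_j a j ^+ 2 -
                       2 * (a i * \sum_j a j))).
  apply: eq_bigr => i _.
  rewrite sumrB big_split/= sumr_const card_ord -!mulr_sumr.
  by rewrite -[_ *+ n]mulr_natl.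
rewrite sumrB big_split/= sumr_const card_ord -!mulr_sumr -mulr_suml.
by rewrite -[_ *+ n]mulr_natl; ring.
Qed.

Lemma sqnorm_mul_le (m n : nat) (x : 'rV[R]_m) (g : 'M[R]_(m, n)) (b : R) :
  (forall i j, g i j ^+ 2 <= b) ->
  sqnorm (x *m g) <= m%:R * n%:R * b * sqnorm x.
Proof.
move=> gb; apply: (@le_trans _ _ (\sum_(j < n) m%:R * b * sqnorm x)).
  apply: ler_sum => j _; rewrite mxE; apply: le_trans (sqr_sum_le _) _.
  rewrite -mulrA ler_wpM2l// mulr_sumr ler_sum// => i _.
  by rewrite exprMn mulrC ler_wpM2r// sqr_ge0.
by rewrite sumr_const card_ord -[_ *+ n]mulr_natl !mulrA (mulrC n%:R).
Qed.

(** The functional x |-> sup_g |x g|^2 is invariant under the group and, because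
    |x g|^2 bounds |x|^2 up to a constant, uniformly convex.  It therefore has
    exactly one minimiser on a closed set stable under midpoints, and that
    minimiser is fixed as soon as the set is stable under the group.  The
    supremum itself is avoided: [orbit_le t x] says that it is at most t. *)
Lemma bounded_group_fixed_point (N : nat) (G : set 'M[R]_N) (K : R)
    (C : set 'rV[R]_N) :
  G 1%:M -> (forall g h, G g -> G h -> G (g *m h)) ->
  (forall g, G g -> exists2 h, G h & g *m h = 1%:M) ->
  0 < K -> (forall x g, G g -> sqnorm (x *m g) <= K * sqnorm x) ->
  closed C -> C !=set0 ->
  (forall x y, C x -> C y -> C (2^-1 *: (x + y))) ->
  (forall x g, C x -> G g -> C (x *m g)) ->
  exists2 x, C x & forall g, G g -> x *m g = x.
Proof.
move=> G1 GM GV K0 GK Ccl [x0 Cx0] Cmid CG.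
pose orbit_le t x := forall g, G g -> sqnorm (x *m g) <= t.
pose E := [set t | exists2 x, C x & orbit_le t x].
have E0 : E !=set0 by exists (K * sqnorm x0), x0 => // g; exact: GK.
have Elb : lbound E 0.
  by move=> t [x _ /(_ _ G1)]; apply: le_trans; exact: sqnorm_ge0.
have Einf : has_inf E by split => //; exists 0.
pose m := inf E.
pose D e := C `&` orbit_le (m + e).
have Dcl e : closed (D e).
  apply: closedI => //.
  have -> : orbit_le (m + e) =
      \bigcap_(g in G) ((fun x => sqnorm (x *m g)) @^-1` [set t | t <= m + e]).
    by [].
  apply: closed_bigI => g Gg; apply: preimage_closed; last exact: closed_le.
  move=> + _; apply: (continuous_big add_continuous) => i _ x.
  pose f : 'rV[R]_N -> R^o := fun x => (x *m g) ord0 i.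
  have fl : linear f by move=> k u v; rewrite /f mulmxDl -scalemxAl !mxE.
  pose f' : {linear 'rV[R]_N -> R^o} :=
    HB.pack f (GRing.isLinear.Build _ _ _ _ f fl).
  by apply: (@cvgM R _ (nbhs x) _ f f); exact: (@linear_rV_continuous _ _ f').
have Dne e : 0 < e -> D e !=set0.
  move=> e0; have [t [x Cx xt] tm] := inf_adherent e0 Einf.
  exists x; split => // g Gg; exact: le_trans (xt _ Gg) (ltW tm).
have Dbd : bounded_set (D 1).
  exists (m + 1 + 1); split; first exact: num_real.
  move=> M mM x [Cx /(_ _ G1)]; rewrite mulmx1 => xm.
  have M0 : 0 < M.
    by apply: le_lt_trans mM; rewrite addr_ge0// (le_trans (sqnorm_ge0 x)).
  apply: mx_norm_le => [|i j]; first exact: ltW.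
  have : x i j ^+ 2 <= m + 1.
    apply: le_trans xm; rewrite ord1 /sqnorm (bigD1 j)//= lerDl.
    by apply: sumr_ge0 => k _; exact: sqr_ge0.
  by rewrite ler_norml; nra.
(* The sublevel sets D e decrease to the set of minimisers; by compactness
   their intersection is not empty. *)
have [x [Dx1 xcl]] : D 1 `&` cluster (filter_from [set e | 0 < e] D) !=set0.
  apply: (bounded_closed_compact Dbd (Dcl 1)).
    apply: filter_from_proper => //; apply: filter_from_filter.
      by exists 1 => /=.
    move=> e d e0 d0; exists (Num.min e d); first by rewrite /= lt_min e0.
    by move=> x [Cx xb]; split; split => // g Gg; apply: le_trans (xb _ Gg) _;
       rewrite lerD2l ge_min lexx ?orbT.
  by exists 1 => /=.
have Cx : C x by case: Dx1.
have xm : orbit_le m x.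
  move=> g Gg; apply/ler_addgt0Pr => e e0.
  suff [_ /(_ _ Gg)] : D e x by [].
  by apply: (Dcl e) => B Bx; apply: xcl => //; exists e.
exists x => // h Gh; apply/esym/eqP; rewrite -subr_eq0; apply/eqP/sqnorm_eq0.
have Cy := CG _ _ Cx Gh; set y := x *m h in Cy *.
(* The midpoint of x and y would beat the infimum if x and y were distinct. *)
have mxyE : E (m - (4 * K)^-1 * sqnorm (x - y)).
  exists (2^-1 *: (x + y)); first exact: Cmid.
  move=> g Gg; rewrite -scalemxAl mulmxDl sqnorm_mid.
  have xg := xm _ Gg; have yg : sqnorm (y *m g) <= m.
    by rewrite -mulmxA; apply: xm; exact: GM.
  have [k Gk gk] := GV _ Gg.
  have : sqnorm (x - y) <= K * sqnorm ((x - y) *m g).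
    by rewrite -[X in sqnorm X <= _]mulmx1 -gk mulmxA; exact: GK.
  rewrite mulmxBl -ler_pdivrMl// invfM; lra.
have := ge_inf Einf.2 mxyE; rewrite -/m lerBrDl gerDr pmulr_rle0//.
by rewrite invr_gt0 mulr_gt0.
Qed.

Lemma sqnorm_mxvec (m n : nat) (X : 'M[R]_(m, n)) :
  sqnorm (mxvec X) = \sum_i sqnorm (row i X).
Proof.
rewrite /sqnorm (reindex _ (curry_mxvec_bij m n))/= pair_bigA/=.
by apply: eq_bigr => -[i j] _ /=; rewrite mxvecE mxE.
Qed.

Lemma sqnorm_mxvec_tr (m n : nat) (X : 'M[R]_(m, n)) :
  sqnorm (mxvec X^T) = sqnorm (mxvec X).
Proof.
rewrite !sqnorm_mxvec /sqnorm exchange_big/=.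
by apply: eq_bigr => i _; apply: eq_bigr => j _; rewrite !mxE.
Qed.

(** The congruence X |-> g X g^T as a linear map of flattened matrices. *)
Definition congr_mx (n : nat) (g : 'M[R]_n) : 'M[R]_(n * n) :=
  lin_mulmx g *m lin_mulmxr g^T.

Lemma mul_congr_mx (n : nat) (x : 'rV[R]_(n * n)) (g : 'M[R]_n) :
  x *m congr_mx g = mxvec (g *m vec_mx x *m g^T).
Proof. by rewrite -{1}(vec_mxK x) mulmxA !mul_vec_lin. Qed.

Lemma sqnorm_congr_mx_le (n : nat) (g : 'M[R]_n) (b : R) x :
  (forall i j, g i j ^+ 2 <= b) ->
  sqnorm (x *m congr_mx g) <= (n%:R * n%:R * b) ^+ 2 * sqnorm x.
Proof.
move=> gb; rewrite mul_congr_mx.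
have mulr_le (X : 'M[R]_n) :
    sqnorm (mxvec (X *m g^T)) <= n%:R * n%:R * b * sqnorm (mxvec X).
  rewrite !sqnorm_mxvec mulr_sumr ler_sum// => i _.
  by rewrite row_mul sqnorm_mul_le// => j k; rewrite mxE.
have b0 : 0 <= n%:R * n%:R * b.
  case: n g x gb {mulr_le} => [|n] g x gb; first by rewrite !mul0r.
  by rewrite !mulr_ge0// (le_trans _ (gb ord0 ord0))// sqr_ge0.
apply: le_trans (mulr_le _) _; rewrite expr2 -[leRHS]mulrA ler_wpM2l//.
rewrite -sqnorm_mxvec_tr trmx_mul; apply: le_trans (mulr_le _) _.
by rewrite sqnorm_mxvec_tr vec_mxK.
Qed.

(** The fixed point lemma is applied to the congruence action on matrices and to
    the convex set C of those X for which v g X g^T v^T >= |v|^2 for all v and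
    all g in the group.  This condition is stable under the group, and it
    keeps the fixed point away from the degenerate forms; a large multiple of
    the identity satisfies it because the group is bounded. *)
Lemma bounded_group_invariant_form (n : nat) (G : set 'M[R]_n) (b : R) :
  G 1%:M -> (forall g h, G g -> G h -> G (g *m h)) ->
  (forall g, G g -> exists2 h, G h & g *m h = 1%:M) ->
  (forall g i j, G g -> g i j ^+ 2 <= b) ->
  exists S : 'M[R]_n, [/\ S^T = S,
    forall v : 'rV_n, v != 0 -> 0 < (v *m S *m v^T) ord0 ord0 &
    forall g, G g -> g *m S *m g^T = S].
Proof.
move=> G1 GM GV Gb.
pose K : R := n%:R * n%:R * `|b| + 1.
have K0 : 0 < K by rewrite ltr_wpDl// !mulr_ge0.
have Gb' g i j : G g -> g i j ^+ 2 <= `|b|.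
  by move=> Gg; exact: le_trans (Gb _ _ _ Gg) (ler_norm _).
have GK g (v : 'rV_n) : G g -> sqnorm (v *m g) <= K * sqnorm v.
  move=> Gg; apply: (@le_trans _ _ (n%:R * n%:R * `|b| * sqnorm v)).
    by apply: sqnorm_mul_le => i j; exact: Gb'.
  by rewrite ler_wpM2r ?sqnorm_ge0// lerDl.
pose val g (v : 'rV[R]_n) (x : 'rV[R]_(n * n)) : R :=
  (v *m (g *m vec_mx x *m g^T) *m v^T) ord0 ord0.
have val_linear g v : linear (val g v : 'rV[R]_(n * n) -> R^o).
  move=> k x y; rewrite /val linearP/= !mulmxDr mulmxDl mulmxDr mulmxDl.
  by rewrite -!(scalemxAl, scalemxAr) !mxE.
pose valL g v : {linear 'rV[R]_(n * n) -> R^o} :=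
  HB.pack (val g v : _ -> R^o)
    (GRing.isLinear.Build _ _ _ _ _ (val_linear g v)).
pose C := \bigcap_(p in G `*` [set: 'rV[R]_n])
  (val p.1 p.2 @^-1` [set t | sqnorm p.2 <= t]).
pose G' : set 'M[R]_(n * n) := [set congr_mx g | g in G].
have conjM g h : congr_mx g *m congr_mx h = congr_mx (h *m g).
  apply/row_matrixP => i; rewrite !rowE mulmxA !mul_congr_mx mxvecK.
  by rewrite trmx_mul !mulmxA.
have conj1 : congr_mx 1%:M = 1%:M :> 'M[R]_(n * n).
  apply/row_matrixP => i; rewrite !rowE mul_congr_mx mul1mx trmx1 mulmx1.
  by rewrite vec_mxK mulmx1.
have [] := @bounded_group_fixed_point _ G' (K ^+ 2) C.
- by exists 1%:M.
- by move=> _ _ [g Gg <-] [h Gh <-]; exists (h *m g); [exact: GM|].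
- move=> _ [g Gg <-]; have [h Gh gh] := GV _ Gg.
  by exists (congr_mx h); [exists h|rewrite conjM (mulmx1C gh) conj1].
- by rewrite exprn_gt0.
- move=> x _ [g Gg <-]; apply: le_trans (sqnorm_congr_mx_le (b := `|b|) _ _) _.
    by move=> i j; exact: Gb'.
  by rewrite ler_wpM2r ?sqnorm_ge0// lerXn2r// ?nnegrE ?mulr_ge0// ?lerDl// ltW.
- apply: closed_bigI => -[g v] [/= Gg _].
  apply: preimage_closed; last exact: closed_ge.
  by move=> x _; exact: (@linear_rV_continuous _ _ (valL g v)).
- exists (mxvec K%:M) => -[g v] [/= Gg _]; rewrite /val mxvecK.
  rewrite mul_mx_scalar -scalemxAl -scalemxAr -scalemxAl mxE.
  have -> : v *m (g *m g^T) *m v^T = v *m g *m (v *m g)^T.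
    by rewrite trmx_mul !mulmxA.
  rewrite -sqnormE.
  have [h Gh gh] := GV _ Gg.
  by rewrite -[v in sqnorm v <= _]mulmx1 -gh mulmxA; exact: GK.
- move=> x y Cx Cy p pG; have /= := Cx p pG; have /= := Cy p pG.
  have -> : val p.1 p.2 (2^-1 *: (x + y)) =
      2^-1 * (val p.1 p.2 x + val p.1 p.2 y).
    by transitivity (2^-1 *: (valL p.1 p.2 x + valL p.1 p.2 y));
      rewrite -?linearD -?linearZ_LR.
  lra.
- move=> x _ Cx [g Gg <-] [h v] [/= Gh _]; rewrite /val mul_congr_mx mxvecK.
  have := Cx (h *m g, v); rewrite /=/val/= trmx_mul !mulmxA; apply.
  by split => //; exact: GM.
move=> x Cx Gx; pose S := vec_mx x.
have Spos (v : 'rV[R]_n) : v != 0 -> 0 < (v *m S *m v^T) ord0 ord0.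
  move=> v0; have := Cx (1%:M, v) (conj G1 I).
  rewrite /=/val mul1mx trmx1 mulmx1; apply: lt_le_trans.
  rewrite lt_neqAle sqnorm_ge0 andbT; apply: contra v0 => /eqP v0.
  by apply/eqP/sqnorm_eq0; rewrite -v0.
(* The fixed point need not be symmetric. *)
exists (S + S^T); split => [|v v0|g Gg].
- by rewrite linearD/= trmxK addrC.
- rewrite mulmxDr mulmxDl mxE addr_gt0//; first exact: Spos.
  suff -> : v *m S^T *m v^T = (v *m S *m v^T)^T by rewrite mxE Spos.
  by rewrite !trmx_mul trmxK mulmxA.
have SE : g *m S *m g^T = S.
  by rewrite -[LHS]mxvecK -mul_congr_mx Gx//; exists g.
rewrite mulmxDr mulmxDl SE; congr (_ + _).
by rewrite -{2}SE !trmx_mul trmxK mulmxA.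
Qed.
End Sqnorm.

(** * Euclidean structures and their frames *)

Section LinearMaps.
Variable R : realType.
Implicit Types U V W : lmodType R.

Lemma linear_sumZ U W (f : U -> W) (I : Type) (r : seq I) (c : I -> R)
    (e : I -> U) : linear f ->
  f (\sum_(i <- r) c i *: e i) = \sum_(i <- r) c i *: f (e i).
Proof.
move=> fl.
pose g : {linear U -> W} := HB.pack f (GRing.isLinear.Build _ _ _ _ f fl).
rewrite -[f]/(g : U -> W) linear_sum; apply: eq_bigr => i _.
by rewrite linearZ_LR.
Qed.

Definition bilin U V W (f : U -> V -> W) : Prop :=
  (forall v, linear (f^~ v)) /\ (forall u, linear (f u)).

Section Bilin.
Variables (U V W : lmodType R) (f : U -> V -> W) (fP : bilin f).

Lemma bilDl u u' v : f (u + u') v = f u v + f u' v.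
Proof. by have := fP.1 v 1 u u'; rewrite !scale1r. Qed.

Lemma bilDr u v v' : f u (v + v') = f u v + f u v'.
Proof. by have := fP.2 u 1 v v'; rewrite !scale1r. Qed.

Lemma bil0l v : f 0 v = 0.
Proof. by have := fP.1 v (-1) 0 0; rewrite addr0 scaler0 scaleN1r addNr. Qed.

Lemma bil0r u : f u 0 = 0.
Proof. by have := fP.2 u (-1) 0 0; rewrite addr0 scaler0 scaleN1r addNr. Qed.

Lemma bilZl c u v : f (c *: u) v = c *: f u v.
Proof. by have := fP.1 v c u 0; rewrite bil0l !addr0. Qed.

Lemma bilZr c u v : f u (c *: v) = c *: f u v.
Proof. by have := fP.2 u c v 0; rewrite bil0r !addr0. Qed.

Lemma bilNl u v : f (- u) v = - f u v.
Proof. by rewrite -scaleN1r bilZl scaleN1r. Qed.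

Lemma bil_suml (I : Type) (r : seq I) (e : I -> U) v :
  f (\sum_(i <- r) e i) v = \sum_(i <- r) f (e i) v.
Proof.
elim/big_rec2 : _ => [|i x y _ <-]; [exact: bil0l | exact: bilDl].
Qed.

Lemma bil_sumr (I : Type) (r : seq I) (e : I -> V) u :
  f u (\sum_(i <- r) e i) = \sum_(i <- r) f u (e i).
Proof.
elim/big_rec2 : _ => [|i x y _ <-]; [exact: bil0r | exact: bilDr].
Qed.
End Bilin.

Definition inner_product V (B : V -> V -> R^o) : Prop :=
  [/\ bilin B, forall a b, B a b = B b a & forall a, a != 0 -> 0 < B a a].

Definition expands V (B : V -> V -> R^o) (e : seq V) (a : V) : Prop :=
  a = \sum_(x <- e) B a x *: x.

(** A Parseval frame.  An orthonormal basis is one; orthonormality itself is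
    never used, only this expansion. *)
Definition frame V (B : V -> V -> R^o) (e : seq V) : Prop :=
  forall a, expands B e a.

Section Frame.
Variables (V : lmodType R) (B : V -> V -> R^o) (BP : inner_product B).
Let bilB : bilin B. Proof. by case: BP. Qed.
Let symB a b : B a b = B b a. Proof. by case: BP. Qed.
Let posB a : a != 0 -> 0 < B a a. Proof. by case: BP => _ _; exact. Qed.

Lemma inner_ge0 a : 0 <= B a a.
Proof.
have [->|/posB/ltW//] := eqVneq a 0.
by rewrite (bil0l bilB).
Qed.

Lemma inner_le0 a : B a a <= 0 -> a = 0.
Proof. by apply: contraTeq => /posB; rewrite ltNge. Qed.

Lemma inner_ext a b : (forall c, B a c = B b c) -> a = b.
Proof.
move=> ab; apply/eqP; rewrite -subr_eq0; apply/eqP/inner_le0.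
by rewrite (bilDl bilB) (bilNl bilB) ab subrr.
Qed.

Lemma expandsD (e : seq V) k a b :
  expands B e a -> expands B e b -> expands B e (k *: a + b).
Proof.
rewrite /expands => {1}-> {1}->; rewrite scaler_sumr -big_split/=.
by apply: eq_bigr => x _; rewrite (bilDl bilB) (bilZl bilB) scalerDl scalerA.
Qed.

Lemma expands_sum (e : seq V) (I : eqType) (r : seq I) (c : I -> R)
    (v : I -> V) :
  {in r, forall i, expands B e (v i)} -> expands B e (\sum_(i <- r) c i *: v i).
Proof.
move=> rv; rewrite big_seq; elim/big_rec : _ => [|i x /rv iE xE].
  by rewrite /expands big1// => x _; rewrite (bil0l bilB) scale0r.
exact: expandsD.
Qed.

(** Adding a vector x to s changes e only if x has a nonzero component y
    orthogonal to e, in which case y normalised joins e.  The first conjunct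
    makes e expand its own entries, which is what turns y into a vector
    orthogonal to all of e. *)
Lemma gram_schmidt (s : seq V) : exists e : seq V,
  {in e, forall z, expands B e z} /\ {in s, forall z, expands B e z}.
Proof.
elim: s => [|x s [e [ee es]]]; first by exists [::].
pose p := \sum_(z <- e) B x z *: z; pose y := x - p.
have orth z : expands B e z -> B y z = 0.
  move=> zE; rewrite /y (bilDl bilB) (bilNl bilB) {1}zE.
  rewrite (bil_sumr bilB) (bil_suml bilB) -sumrB.
  by rewrite big1 // => t _; rewrite (bilZr bilB) (bilZl bilB) symB; apply/eqP;
    rewrite subr_eq0 /GRing.scale/= mulrC [B t z]symB.
have [y0|y0] := eqVneq y 0.
  exists e; split => // z; rewrite inE => /predU1P[->|]; last exact: es.
  by apply/eqP; rewrite -subr_eq0; apply/eqP.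
pose k := Num.sqrt (B y y); have k0 : k != 0 by rewrite gt_eqF// sqrtr_gt0 posB.
have kk : k * k = B y y by rewrite -expr2 sqr_sqrtr// inner_ge0.
pose u := k^-1 *: y.
have ext z : expands B e z -> expands B (u :: e) z.
  move=> zE; rewrite /expands big_cons.
  by rewrite (bilZr bilB) [B z y]symB orth// scaler0 scale0r add0r.
have extu : expands B (u :: e) u.
  rewrite /expands big_cons big1_seq ?addr0 => [|z /= ze].
    have -> : B u u = 1.
      by rewrite (bilZl bilB) (bilZr bilB) -kk /GRing.scale/=; field.
    by rewrite scale1r.
  by rewrite (bilZl bilB) orth ?scaler0 ?scale0r//; exact: ee.
exists (u :: e); split => z; rewrite inE => /predU1P[->|ze] //.
- exact/ext/ee.
- have -> : x = k *: u + p.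
    by rewrite /u scalerA divff// scale1r subrK.
  apply: expandsD => //; rewrite /p.
  by apply: expands_sum => t te; exact/ext/ee.
- exact/ext/es.
Qed.

(** The tensor sum e_i (x) e_i represents the identity map, so an operator on
    one leg equals its adjoint on the other. *)
Lemma frame_adjoint W (e : seq V) (f : V -> V -> W) (s s' : V -> V) :
  frame B e -> bilin f -> (forall a b, B (s a) b = B a (s' b)) ->
  \sum_(x <- e) f (s x) x = \sum_(x <- e) f x (s' x).
Proof.
move=> eP fP ss'.
transitivity (\sum_(x <- e) \sum_(y <- e) B (s x) y *: f y x).
  apply: eq_bigr => x _; rewrite [in LHS](eP (s x)) (bil_suml fP).
  by apply: eq_bigr => y _; rewrite (bilZl fP).
rewrite exchange_big/=; apply: eq_bigr => y _.
rewrite [in RHS](eP (s' y)) (bil_sumr fP); apply: eq_bigr => x _.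
by rewrite (bilZr fP) ss' symB.
Qed.

End Frame.

Lemma exists_frame (V : vectType R) (B : V -> V -> R^o) :
  inner_product B -> exists e, frame B e.
Proof.
move=> BP; have [e [_ eP]] := gram_schmidt BP (vbasis {:V}).
exists e => a; rewrite (coord_vbasis (memvf a)).
apply: expands_sum => // i _.
by apply: eP; rewrite mem_nth// size_tuple.
Qed.

(** The trace of a linear map does not depend on the inner product and the frame
    that compute it. *)
Lemma frame_trace (V : vectType R) (B B' : V -> V -> R^o) (e e' : seq V)
    (T : V -> V) : inner_product B -> inner_product B' -> linear T ->
  frame B e -> frame B' e' ->
  \sum_(x <- e) B (T x) x = \sum_(x <- e') B' (T x) x.
Proof.
move=> BP BP' Tl eP eP'; have [bilB _ _] := BP; have [bilB' symB' _] := BP'.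
transitivity (\sum_(x <- e) \sum_(y <- e') B' x y * B (T y) x).
  apply: eq_bigr => x _; rewrite {1}(eP' x) linear_sumZ// (bil_suml bilB).
  by apply: eq_bigr => y _; rewrite (bilZl bilB).
rewrite exchange_big/=; apply: eq_bigr => y _.
rewrite [in RHS](eP (T y)) (bil_suml bilB'); apply: eq_bigr => x _.
by rewrite (bilZl bilB') mulrC.
Qed.

End LinearMaps.

(** * The trace form of an algebra with involution *)

(** Reduces identities in the additive group of V to identities between real
    numbers, which are decidable by linear arithmetic. *)
Lemma linear_ext (R : realType) (V : vectType R) (a b : V) :
  (forall f : {linear V -> R^o}, f a = f b) -> a = b.
Proof.
move=> ab; rewrite (coord_vbasis (memvf a)) (coord_vbasis (memvf b)).
by apply: eq_bigr => i _; rewrite (ab (coord (vbasis {:V}) i)).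
Qed.

Section StarProducts.
Variables (R : realType) (A : falgType R) (star : {linear A -> A}).
Hypothesis starP : star_involution star.

Let starM a b : star (a * b) = star b * star a. Proof. exact: starP.1. Qed.
Let starK a : star (star a) = a. Proof. exact: starP.2. Qed.

Lemma star1 : star 1 = 1.
Proof. by rewrite -[LHS]mulr1 -[X in _ * X]starK -starM mulr1 starK. Qed.

Definition star_product (B : A -> A -> R^o) : Prop :=
  inner_product B /\ forall a b c, B (a * b) c = B b (star a * c).

Section Trace.
Variables (B : A -> A -> R^o) (e : seq A).
Hypotheses (BP : star_product B) (eP : frame B e).
Let bilB : bilin B. Proof. by case: BP => -[]. Qed.
Let symB a b : B a b = B b a. Proof. by case: BP => -[]. Qed.
Let adjB a b c : B (a * b) c = B b (star a * c). Proof. exact: BP.2. Qed.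

(** The trace of left multiplication by a. *)
Definition trace_form (a : A) : R^o := \sum_(x <- e) B (a * x) x.

Lemma trace_formP : linear trace_form.
Proof.
move=> k a b; rewrite /trace_form scaler_sumr -big_split/=.
by apply: eq_bigr => x _; rewrite mulrDl -scalerAl (bilDl bilB) (bilZl bilB).
Qed.

Lemma trace_star a : trace_form (star a) = trace_form a.
Proof. by apply: eq_bigr => x _; rewrite adjB starK symB. Qed.

Lemma trace_mulC a b : trace_form (a * b) = trace_form (b * a).
Proof.
have fP : bilin (fun x y : A => B (a * x) y : R^o).
  split=> [y k x x'|x k y y'].
    by rewrite mulrDr -scalerAr (bilDl bilB) (bilZl bilB).
  by rewrite (bilDr bilB) (bilZr bilB).
transitivity (\sum_(x <- e) B (a * (b * x)) x).
  by apply: eq_bigr => x _; rewrite mulrA.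
rewrite (frame_adjoint BP.1 eP fP (s := *%R b) (s' := *%R (star b))) => [|x y].
  by apply: eq_bigr => x _; rewrite symB adjB starK symB mulrA.
exact: adjB.
Qed.

Definition trace_product (a b : A) : R^o := trace_form (a * star b).

(** Positivity: tr(L_{a a^*}) is the squared Hilbert-Schmidt norm of L_{a^*} for
    B.  The adjunction rule is the cyclicity of the trace. *)
Lemma trace_productP : star_product trace_product.
Proof.
split; last first.
  by move=> a b c; rewrite /trace_product starM starK -mulrA trace_mulC mulrA.
split.
- split=> [b k a a'|a k b b']; rewrite /trace_product.
    by rewrite mulrDl -scalerAl trace_formP.
  by rewrite linearP mulrDr -scalerAr trace_formP.
- by move=> a b; rewrite /trace_product -trace_star starM starK.
- move=> a a0.
  have E : trace_product a a = \sum_(x <- e) B (star a * x) (star a * x).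
    by apply: eq_bigr => x _; rewrite -mulrA adjB.
  rewrite lt_neqAle E sumr_ge0 ?andbT; last first.
    by move=> x _; exact: inner_ge0 BP.1 _.
  apply: contra a0 => /eqP/esym E0.
  have sa0 x : star a * x = 0.
    rewrite (eP x) mulr_sumr big1_seq// => y /= ye.
    rewrite -scalerAr; suff -> : star a * y = 0 by rewrite scaler0.
    apply: (inner_le0 BP.1); rewrite -E0 (perm_big _ (perm_to_rem ye)) big_cons.
    by rewrite lerDl sumr_ge0// => z _; exact: inner_ge0 BP.1 _.
  by rewrite -(starK a) -[star a]mulr1 sa0 linear0.
Qed.

Lemma trace_product_star a b :
  trace_product (star a) (star b) = trace_product a b.
Proof.
by rewrite /trace_product starK trace_mulC -trace_star starM starK.
Qed.

(** Paired with c, the left side is the trace of left multiplication by c, that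
    is, the pairing of 1 with c: this normalisation is special to the trace
    form of the regular representation. *)
Lemma trace_product_casimir (e' : seq A) : frame trace_product e' ->
  \sum_(x <- e') x * star x = 1.
Proof.
move=> eP'; have [[bilT symT _] adjT] := trace_productP.
have adjTr x y c : trace_product (x * y) c = trace_product x (c * star y).
  by rewrite /trace_product starM starK mulrA.
apply: (inner_ext trace_productP.1) => c.
rewrite (bil_suml bilT).
transitivity (\sum_(x <- e') trace_product (c * x) x).
  by apply: eq_bigr => x _; rewrite adjTr starK symT.
rewrite (frame_trace (B' := B) (e' := e) (T := fun x => c * x)
  trace_productP.1 BP.1)//; last first.
  by move=> k x y; rewrite mulrDr scalerAr.
by rewrite /trace_product mul1r trace_star.
Qed.
End Trace.

Lemma exists_trace_frame (B0 : A -> A -> R^o) : star_product B0 ->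
  exists B e, [/\ star_product B, forall a b, B (star a) (star b) = B a b,
    frame B e & \sum_(x <- e) x * star x = 1].
Proof.
move=> B0P; have [e0 e0P] := exists_frame B0P.1.
have [e eP] := exists_frame (trace_productP B0P e0P).1.
exists (trace_product B0 e0), e; split => //.
- exact: trace_productP.
- exact: trace_product_star.
- exact: (trace_product_casimir B0P e0P eP).
Qed.

(** * Solving a linear equation over the algebra *)

Section Core.
Variables (B : A -> A -> R^o) (e : seq A).
Hypotheses (BP : star_product B).
Hypothesis (Bstar : forall a b, B (star a) (star b) = B a b).
Hypotheses (eP : frame B e) (e1 : \sum_(x <- e) x * star x = 1).
Let bilB : bilin B. Proof. by case: BP => -[]. Qed.
Let symB a b : B a b = B b a. Proof. by case: BP => -[]. Qed.
Let adjBl a b c : B (a * b) c = B b (star a * c). Proof. exact: BP.2. Qed.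
Let adjBr a b c : B (b * a) c = B b (c * star a).
Proof. by rewrite -Bstar starM adjBl starK -Bstar starK starM starK. Qed.

Lemma frame_mull (W : lmodType R) (f : A -> A -> W) a : bilin f ->
  \sum_(x <- e) f (a * x) x = \sum_(x <- e) f x (star a * x).
Proof. move=> fP; apply: (frame_adjoint BP.1 eP fP (s := *%R a)) => x y.
exact: adjBl. Qed.

Lemma frame_mulr (W : lmodType R) (f : A -> A -> W) a : bilin f ->
  \sum_(x <- e) f (x * a) x = \sum_(x <- e) f x (x * star a).
Proof. move=> fP; apply: (frame_adjoint BP.1 eP fP (s := *%R^~ a)) => x y.
exact: adjBr. Qed.

Lemma frame_star (W : lmodType R) (f : A -> A -> W) : bilin f ->
  \sum_(x <- e) f (star x) x = \sum_(x <- e) f x (star x).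
Proof.
move=> fP; apply: (frame_adjoint BP.1 eP fP) => x y.
by rewrite -{1}(starK y) Bstar.
Qed.

(** The element D is skew and its square vanishes; positivity of B then forces
    D = 0. *)
Lemma re_scale_inj D : (forall a, a * D + star D * star a = 0) -> D = 0.
Proof.
move=> D0; have sD : star D = - D.
  apply/eqP; rewrite -addr_eq0.
  by have := D0 1; rewrite mul1r star1 mulr1 addrC => ->.
apply: (inner_le0 BP.1).
have DD : D * D = 0.
  have := D0 D; rewrite sD mulrNN => /eqP.
  rewrite -mulr2n -scaler_nat scaler_eq0.
  by rewrite pnatr_eq0 => /eqP.
by rewrite -{1}[D]mulr1 adjBl sD mulNr DD oppr0 (bil0r bilB).
Qed.

(** The map tau of the introduction: an algebraic form of the average of u a u
    over the unitary group. *)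
Definition twist (a : A) : A := \sum_(x <- e) star x * a * star x.

Lemma bilin_sandwich a : bilin (fun x y : A => x * a * y).
Proof.
split=> [y k x x'|x k y y']; first by rewrite !mulrDl -!scalerAl.
by rewrite !mulrDr -!scalerAr.
Qed.

Lemma twistE a : twist a = \sum_(x <- e) x * a * x.
Proof.
transitivity (\sum_(x <- e) x * a * star (star x)).
  apply: (frame_star (f := fun x y => x * a * star y)).
  split=> [y k x x'|x k y y']; first by rewrite !mulrDl -!scalerAl.
  by rewrite linearP !mulrDr -!scalerAr.
by apply: eq_bigr => x _; rewrite starK.
Qed.

Lemma twist_star a : twist (star a) = star (twist a).
Proof.
rewrite twistE /twist linear_sum; apply: eq_bigr => x _.
by rewrite !starM starK mulrA.
Qed.

Lemma twist_mull a b : twist (a * b) = twist b * star a.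
Proof.
rewrite !twistE mulr_suml.
have := frame_mulr a (bilin_sandwich b) => E.
transitivity (\sum_(x <- e) x * a * b * x).
  by apply: eq_bigr => x _; rewrite !mulrA.
by rewrite E; apply: eq_bigr => x _; rewrite !mulrA.
Qed.

Lemma twist_mulr a b : twist (b * a) = star a * twist b.
Proof.
rewrite -{1}(starK (b * a)) starM twist_star twist_mull starM starK twist_star.
by rewrite starK.
Qed.

Lemma twistD a b : twist (a + b) = twist a + twist b.
Proof.
by rewrite /twist -big_split/=; apply: eq_bigr => x _; rewrite mulrDr mulrDl.
Qed.

Lemma twistZ k a : twist (k *: a) = k *: twist a.
Proof.
rewrite /twist scaler_sumr; apply: eq_bigr => x _.
by rewrite -scalerAr -scalerAl.
Qed.

Lemma add_twist_linear : linear (fun a => a + twist (star a)).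
Proof.
move=> k a b; rewrite linearP twistD twistZ scalerDr !addrA.
by congr (_ + _); rewrite addrAC.
Qed.

Lemma inner_twist a :
  \sum_(x <- e) B (x * a + star a * star x) (x * a + star a * star x) =
  2 * B a (a + twist (star a)).
Proof.
have tot : \sum_(x <- e) B (x * a) (x * a) = B a a.
  have xx1 : \sum_(x <- e) star x * x = 1.
    by have := frame_star (bilin_sandwich 1); under eq_bigr do rewrite mulr1;
       move=> ->; rewrite -[RHS]e1; apply: eq_bigr => x _; rewrite mulr1.
  transitivity (B a (1 * a)); last by rewrite mul1r.
  rewrite -xx1 mulr_suml (bil_sumr bilB).
  by apply: eq_bigr => x _; rewrite adjBl mulrA.
have cross : \sum_(x <- e) B (x * a) (star a * star x) = B a (twist (star a)).
  by rewrite (bil_sumr bilB); apply: eq_bigr => x _; rewrite adjBl mulrA.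
transitivity (\sum_(x <- e) (2 * B (x * a) (x * a) +
                             2 * B (x * a) (star a * star x))).
  apply: eq_bigr => x _; rewrite !(bilDl bilB) !(bilDr bilB).
  rewrite [B (star a * _) (x * a)]symB -[star a * star x]starM Bstar; lra.
by rewrite big_split/= -!mulr_sumr tot cross (bilDr bilB) mulrDr.
Qed.

(** By [inner_twist] every x a + a^* x^* with x in the frame vanishes; the frame
    spans, so this holds for all x, and [re_scale_inj] applies. *)
Lemma add_twist_inj a : a + twist (star a) = 0 -> a = 0.
Proof.
move=> a0; apply: re_scale_inj => b.
have z0 x : x \in e -> x * a + star a * star x = 0.
  move=> xe; apply: (inner_le0 BP.1).
  have := inner_twist a; rewrite a0 (bil0r bilB) mulr0 => <-.
  rewrite [leRHS](perm_big _ (perm_to_rem xe)) big_cons.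
  by rewrite lerDl sumr_ge0// => z _; exact: inner_ge0 BP.1 _.
rewrite (eP b) linear_sum !(mulr_suml, mulr_sumr) -big_split/=.
rewrite big1_seq// => x /= xe.
by rewrite linearZ_LR/= -scalerAl -scalerAr -scalerDr z0// scaler0.
Qed.

Lemma add_twist_surj k : exists a, a + twist (star a) = k.
Proof.
pose f : {linear A -> A} := HB.pack (fun a => a + twist (star a))
  (GRing.isLinear.Build _ _ _ _ _ add_twist_linear).
have f0 : lker (linfun f) == 0%VS.
  apply/lker0P => a b; rewrite !lfunE => ab; apply/eqP.
  rewrite -subr_eq0; apply/eqP/add_twist_inj.
  by have := linearB f a b; rewrite ab subrr.
have /memv_imgP[a _ ->] : k \in limg (linfun f) by rewrite lker0_limgf ?memvf.
by exists a; rewrite lfunE.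
Qed.


(** Here h(a, b) stands for H(ax, by).  The second variable enters only through
    the polarised identity [hpol], whose contraction against the frame yields
    the equation [hK] for h(_, 1) alone. *)
Lemma re_scale_exists (h : A -> A -> A) : bilin h ->
  (forall a b, star (h a b) = h a b) ->
  (forall c a b, h (c * a) (c * b) = c * h a b * star c) ->
  exists Q, forall a, h a 1 = a * Q + star Q * star a.
Proof.
move=> hP hstar hM.
have hpol c d a b : h (c * a) (d * b) + h (d * a) (c * b) =
    c * h a b * star d + d * h a b * star c.
  have := hM (c + d) a b; rewrite linearD !mulrDl !mulrDr.
  rewrite !(bilDl hP) !(bilDr hP) !hM.
  move=> E; apply: linear_ext => f; move/(congr1 f): E.
  rewrite !linearD/=; lra.
pose K := \sum_(x <- e) x * h (star x) 1.
have Kmul a : \sum_(x <- e) x * h (star x * a) 1 = a * K.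
  have fP : bilin (fun x y => x * h (star y) 1).
    split=> [y k x x'|x k y y']; first by rewrite mulrDl -scalerAl.
    by rewrite linearP (bilDl hP) (bilZl hP) mulrDr -scalerAr.
  have := frame_mull a fP.
  rewrite (eq_bigr (fun x => a * (x * h (star x) 1))); last first.
    by move=> x _; rewrite mulrA.
  rewrite -mulr_sumr => ->.
  by apply: eq_bigr => x _; rewrite starM starK.
have hK a : h a 1 + twist (h a 1) = a * K + star K * star a.
  (* D vanishes on the diagonal, so it is alternating, whereas the tensor
     sum e_i^* (x) e_i is symmetric: the contraction of D is zero. *)
  pose D c d := h (c * a) d - c * h a 1 * star d.
  have DP : bilin D.
    split=> [d k c c'|c k d d']; rewrite /D.
      rewrite !mulrDl -!scalerAl (bilDl hP) (bilZl hP) scalerBr opprD !addrA.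
      by congr (_ - _); rewrite addrAC.
    rewrite linearP mulrDr -scalerAr (bilDr hP) (bilZr hP) scalerBr opprD.
    by rewrite !addrA; congr (_ - _); rewrite addrAC.
  have DC c d : D c d = - D d c.
    apply/eqP; rewrite -addr_eq0 /D addrACA -opprD subr_eq0; apply/eqP.
    by have := hpol c d a 1; rewrite !mulr1.
  have D0 : \sum_(x <- e) D (star x) x = 0.
    have DN : \sum_(x <- e) D (star x) x = - \sum_(x <- e) D (star x) x.
      rewrite {1}(frame_star DP) -sumrN.
      by apply: eq_bigr => x _; rewrite DC.
    move/eqP: DN; rewrite -addr_eq0 -mulr2n -scaler_nat scaler_eq0.
    by rewrite pnatr_eq0 => /eqP.
  have -> : twist (h a 1) = \sum_(x <- e) h (star x * a) x.
    by apply/esym/eqP; rewrite -subr_eq0 -sumrB D0.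
  rewrite -Kmul -[star K * _]starK starM !starK -Kmul linear_sum -big_split/=.
  have <- : \sum_(x <- e) h (x * (star x * a)) 1 = h a 1.
    rewrite -(bil_suml hP); congr (h _ 1).
    by rewrite -[RHS]mul1r -e1 mulr_suml; apply: eq_bigr => x _; rewrite mulrA.
  rewrite -big_split/=; apply: eq_bigr => x _.
  have := hpol x 1 (star x * a) 1; rewrite !mul1r !mulr1 star1 mulr1 => ->.
  by rewrite starM hstar.
have [Q QK] := add_twist_surj K; exists Q => a.
pose M := h a 1 - (a * Q + star Q * star a).
have sM : star M = M.
  rewrite /M linearB linearD hstar !starM !starK; congr (_ - _).
  by rewrite addrC.
suff : M = 0 by move/eqP; rewrite subr_eq0 => /eqP.
apply: add_twist_inj; rewrite sM /M.
have twB x y : twist (x - y) = twist x - twist y.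
  by rewrite twistD -scaleN1r twistZ scaleN1r.
rewrite twB twistD twist_mull twist_mulr starK addrACA hK -QK.
rewrite [star (_ + _)]linearD/= -[star (twist _)]twist_star starK mulrDr mulrDl.
by apply: linear_ext => f; rewrite !(linearD, linearN) linear0/=; lra.
Qed.

End Core.
End StarProducts.

(** * The Euclidean structure of a polarizable algebra *)

Section InvariantProduct.
Variables (R : realType) (A : falgType R) (star : {linear A -> A}).
Hypothesis starP : star_involution star.
Let n := \dim {:A}.
Let bs := vbasis {:A}.
Let r : A -> 'rV[R]_n := @coordinates R A.

Let starM a b : star (a * b) = star b * star a. Proof. exact: starP.1. Qed.
Let starK a : star (star a) = a. Proof. exact: starP.2. Qed.

(** Left multiplication by u^* is injective, hence onto in finite dimension. *)
Lemma unitary_mulV u : unitary_group star u -> star u * u = 1.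
Proof.
rewrite /unitary_group/= => uu.
have inj : lker (amull (star u)) == 0%VS.
  apply/lker0P => x y; rewrite !lfunE/= => xy.
  by rewrite -[x]mul1r -[y]mul1r -uu -!mulrA xy.
have /memv_imgP[x _] : 1 \in limg (amull (star u)).
  by rewrite lker0_limgf ?memvf.
rewrite lfunE/= => x1.
have xu : x = u by rewrite -[x]mul1r -uu -mulrA -x1 mulr1.
by rewrite x1 xu.
Qed.

Lemma unitaryM u v : unitary_group star u -> unitary_group star v ->
  unitary_group star (u * v).
Proof.
by rewrite /unitary_group/= => uu vv; rewrite starM mulrA -(mulrA u) vv mulr1.
Qed.

Lemma unitaryV u : unitary_group star u -> unitary_group star (star u).
Proof. by move=> uu; rewrite /unitary_group/= starK unitary_mulV. Qed.

Lemma coordinates_linear : linear r.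
Proof. by move=> k a b; apply/rowP => i; rewrite !mxE linearP. Qed.

HB.instance Definition _ := GRing.isLinear.Build _ _ _ _ r coordinates_linear.

Lemma coordinatesK a : \sum_i r a ord0 i *: bs`_i = a.
Proof.
by rewrite [RHS](coord_vbasis (memvf a)); apply: eq_bigr => i _; rewrite mxE.
Qed.

Lemma coordinates_eq0 a : r a = 0 -> a = 0.
Proof.
by move=> a0; rewrite -(coordinatesK a) big1// => i _; rewrite a0 mxE scale0r.
Qed.

(** Coordinates are row vectors, so that [lmul_mx] reverses products
    ([lmul_mxM]). *)
Definition lmul_mx (u : A) : 'M[R]_n := \matrix_i r (u * bs`_i).

Lemma lmul_mxE u a : r (u * a) = r a *m lmul_mx u.
Proof.
rewrite -{1}(coordinatesK a) mulr_sumr linear_sum mulmx_sum_row.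
by apply: eq_bigr => i _; rewrite rowK -scalerAr linearZ.
Qed.

Lemma lmul_mxM u v : lmul_mx (u * v) = lmul_mx v *m lmul_mx u.
Proof.
by apply/row_matrixP => i; rewrite row_mul !rowK -mulrA lmul_mxE.
Qed.

Lemma lmul_mx1 : lmul_mx 1 = 1%:M.
Proof.
apply/row_matrixP => i; rewrite rowK mul1r; apply/rowP => j.
rewrite [LHS]mxE [RHS]mxE mxE.
have bf : free bs by exact: (basis_free (vbasisP {:A})).
by rewrite (coord_free i j bf).
Qed.

Lemma unitary_coordinates_bounded :
  compact (unitary_group star : set (natural A)) ->
  exists M, forall u, unitary_group star u -> `|r u| <= M.
Proof.
move=> Gc.
have rc : continuous (r : natural A -> 'rV[R]_n) by exact: initial_continuous.
have [M [_ MG]] :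
    bounded_set ((r : natural A -> 'rV[R]_n) @` unitary_group star).
  apply: compact_bounded; apply: (@continuous_compact (natural A)) => //.
  exact: continuous_subspaceT.
by exists (M + 1) => u uG; apply: MG; [rewrite ltrDl | exists u].
Qed.

Lemma lmul_mx_bounded M : exists b, forall u, `|r u| <= M ->
  forall i j, lmul_mx u i j ^+ 2 <= b.
Proof.
pose T (i j : 'I_n) : R := \sum_(k < n) `|r (bs`_k * bs`_i) ord0 j|.
exists (\sum_i \sum_j (M * T i j) ^+ 2) => u uM i j.
have M0 : 0 <= M by exact: le_trans uM.
have uT : `|lmul_mx u i j| <= M * T i j.
  rewrite mxE -{1}(coordinatesK u) mulr_suml linear_sum summxE /T mulr_sumr.
  apply: le_trans (ler_norm_sum _ _ _) _; apply: ler_sum => k _.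
  rewrite -scalerAl linearZ mxE normrM ler_wpM2r//.
  exact: le_trans (entry_le_mx_norm _ _ _) uM.
apply: (@le_trans _ _ ((M * T i j) ^+ 2)).
  by rewrite -real_normK ?num_real// lerXn2r ?nnegrE// (le_trans _ uT).
rewrite (bigD1 i)//= (bigD1 j)//= -addrA lerDl addr_ge0// sumr_ge0// => k _.
  exact: sqr_ge0.
by apply: sumr_ge0 => l _; exact: sqr_ge0.
Qed.

Lemma exists_star_product : polarizable star ->
  exists B : A -> A -> R^o, star_product star B.
Proof.
move=> [Gc Ggen]; have [M GM] := unitary_coordinates_bounded Gc.
have [b Lb] := lmul_mx_bounded M.
have [] := @bounded_group_invariant_form R n
  [set lmul_mx u | u in unitary_group star] b.
- by exists 1; rewrite ?lmul_mx1// /unitary_group/= star1// mulr1.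
- move=> _ _ [u uG <-] [v vG <-]; exists (v * u); rewrite ?lmul_mxM//.
  exact: unitaryM.
- move=> _ [u uG <-]; exists (lmul_mx (star u)).
    by exists (star u) => //; exact: unitaryV.
  by rewrite -lmul_mxM unitary_mulV// lmul_mx1.
- by move=> _ i j [u uG <-]; apply: Lb; exact: GM.
move=> S [ST Spos SG].
pose B (a c : A) : R^o := (r a *m S *m (r c)^T) ord0 ord0.
have bilB : bilin B.
  split=> [c k a a'|a k c c']; rewrite /B.
    by rewrite linearP !mulmxDl -!scalemxAl !mxE.
  by rewrite linearP/= linearP/= mulmxDr -scalemxAr !mxE.
have symB a c : B a c = B c a.
  rewrite /B -[in LHS](trmxK (r a *m S *m (r c)^T)) mxE.
  by rewrite !trmx_mul trmxK ST mulmxA.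
exists B; split.
  split=> // a a0; apply: Spos; apply: contraNneq a0 => /coordinates_eq0 ->//.
(* The elements that obey the adjunction rule form a *-subalgebra. *)
pose C := [pred x : A | `[< forall a c, B (x * a) c = B a (star x * c) >]].
have CP x : x \in C <-> forall a c, B (x * a) c = B a (star x * c).
  by split=> [/asboolP//|?]; exact/asboolP.
move=> x; suff: x \in C by move/CP.
apply: Ggen x => [|u uG]; last first.
  apply/CP => a c.
  have Binv y z : B (u * y) (u * z) = B y z.
    rewrite /B !lmul_mxE trmx_mul -[in RHS](SG (lmul_mx u)) ?mulmxA//.
    by exists u.
  by rewrite -[in RHS]Binv mulrA uG mul1r.
split; first split.
- by apply/CP => a c; rewrite star1// !mul1r.
- move=> k x y /CP xC /CP yC; apply/CP => a c.
  rewrite mulrDl -scalerAl linearP mulrDl -scalerAl (bilDl bilB) (bilZl bilB).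
  by rewrite xC yC (bilDr bilB) (bilZr bilB).
- move=> x y /CP xC /CP yC; apply/CP => a c.
  by rewrite -mulrA xC yC starM mulrA.
- by move=> x /CP xC; apply/CP => a c; rewrite symB -xC starK symB.
Qed.
End InvariantProduct.

(** * The polar form of a quadrance *)

(** The defect g(x) = f(x) - x f(1) is additive and vanishes at the rationals;
    every real is a rational plus a small remainder, so g is bounded
    everywhere, and additive bounded functions vanish. *)
Lemma additive_bounded_linear (R : realType) (f : R -> R) (d M : R) :
  {morph f : x y / x + y} -> 0 < d -> (forall t, `|t| < d -> `|f t| <= M) ->
  forall t, f t = t * f 1.
Proof.
move=> fD d0 fM t.
pose g x := f x - x * f 1.
have gD : {morph g : x y / x + y} by move=> x y; rewrite /g fD mulrDl; lra.
have g0 : g 0 = 0 by have := gD 0 0; rewrite addr0; lra.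
have gMn n x : g (n%:R * x) = n%:R * g x.
  elim: n => [|n IH]; first by rewrite !mul0r.
  by rewrite -natr1 !mulrDl !mul1r gD IH.
have gN x : g (- x) = - g x by have := gD x (- x); rewrite subrr g0; lra.
have g1 : g 1 = 0 by rewrite /g mul1r subrr.
have gz (k : int) : g k%:~R = 0.
  case: k => k; first by have := gMn k 1; rewrite g1 mulr0 mulr1.
  rewrite NegzE mulrNz gN; have := gMn k.+1 1.
  by rewrite g1 mulr0 mulr1 => ->; rewrite oppr0.
pose k := (Num.truncn d^-1).+1.
have k0 : 0 < k%:R :> R by rewrite ltr0n.
have k1 : k%:R != 0 :> R by rewrite gt_eqF.
have kd : k%:R^-1 < d.
  by rewrite -[d]invrK ltf_pV2 ?posrE ?invr_gt0// truncnS_gt.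
have gM x : `|g x| <= M + d * `|f 1|.
  pose m : R := (Num.floor (x * k%:R))%:~R.
  have gm : g (m / k%:R) = 0.
    have := gMn k (m / k%:R); rewrite mulrC divfK // gz => /esym/eqP.
    by rewrite mulf_eq0 (negPf k1)/= => /eqP.
  have /andP[mx xm] : m <= x * k%:R < m + 1.
    by have := floor_itv (x * k%:R); rewrite intrD.
  pose y := x - m / k%:R.
  have y0 : 0 <= y by rewrite subr_ge0 ler_pdivrMr.
  have yd : y < d.
    apply: lt_trans kd; rewrite /y -[x](mulfK k1) -mulrBl.
    by rewrite ltr_pdivrMr// mulVf // ltrBlDl.
  have -> : g x = g y by rewrite -[x in LHS](subrK (m / k%:R)) gD gm addr0.
  apply: le_trans (ler_normB _ _) _; apply: lerD.
    by apply: fM; rewrite ger0_norm.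
  by rewrite normrM ger0_norm// ler_wpM2r// ltW.
have gn n : n%:R * `|g t| <= M + d * `|f 1|.
  by rewrite -[n%:R]normr_nat -normrM -gMn; exact: gM.
apply/eqP; rewrite -subr_eq0 -/(g t) -normr_le0 leNgt; apply/negP => gt0.
have := gn (Num.truncn ((M + d * `|f 1|) / `|g t|)).+1.
rewrite -ler_pdivlMr// leNgt.
by rewrite truncnS_gt.
Qed.

Section Quadrance.
Variables (R : realType) (A : falgType R) (star : {linear A -> A}).
Hypotheses (starP : star_involution star).
Variables (X : lmodType A) (q : X -> A).
Hypothesis quadq : quadrance star q.
Hypothesis qpar : forall x y, q (x + y) + q (x - y) = 2 *: (q x + q y).

Definition polar (x y : X) : A := q (x + y) - q x - q y.

Lemma polarC x y : polar x y = polar y x.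
Proof. by rewrite /polar [x + y]addrC addrAC. Qed.

(** The Jordan-von Neumann argument: additivity is a linear combination of four
    instances of the parallelogram law. *)
Lemma polarDl x y z : polar (x + y) z = polar x z + polar y z.
Proof.
have qN u v : q (u - v) = q (v - u).
  have := qpar u v; have := qpar v u; rewrite [v + u]addrC [q v + q u]addrC.
  by move=> <- /addrI.
have e1 := qpar (x + y) z; have e2 := qpar x (y - z); have e3 := qpar (x + z) y.
have e4 := qpar y z.
rewrite opprB !addrA in e2; rewrite [x + z + y]addrAC [x + z - y]addrAC in e3.
apply: linear_ext => f.
move/(congr1 f): e1; move/(congr1 f): e2; move/(congr1 f): e3.
move/(congr1 f): e4.
rewrite /polar !(linearD, linearN, linearZ_LR)/= /GRing.scale/=.
rewrite (addrAC x z); lra.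
Qed.

Lemma polarDr x y z : polar x (y + z) = polar x y + polar x z.
Proof. by rewrite polarC polarDl polarC [polar z x]polarC. Qed.

(** In t, the polar form at (t x, y) is additive, and near t = 0 it is bounded
    because q(t x + y) is continuous and q(t x) = t^2 q(x). *)
Lemma polar_real (k : R) x y : polar (k%:A *: x) y = k *: polar x y.
Proof.
have [_ qM qc] := quadq.
rewrite (coord_vbasis (memvf (polar _ y))).
rewrite [in RHS](coord_vbasis (memvf (polar x y))).
rewrite scaler_sumr; apply: eq_bigr => i _; rewrite scalerA; congr (_ *: _).
pose f t := coord (vbasis {:A}) i (polar (t%:A *: x) y).
suff fE : forall t, f t = t * f 1 by rewrite -[LHS]/(f k) fE /f scale1r scale1r.
pose c t := coord (vbasis {:A}) i (q (t%:A *: x + y)).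
have c0 : {for 0, continuous c}.
  pose F (ta : R * natural A) : natural A := q (ta.1%:A *: x + (ta.2 : A) *: y).
  have -> : c = (fun v : 'rV[R]__ => v ord0 i) \o (@coordinates R A \o
      (F \o (fun t : R => (t, (1 : A) : natural A)))).
    by apply/funext => t; rewrite /c/= mxE /F/= scale1r.
  apply: continuous_comp; last exact: coord_continuous.
  apply: continuous_comp; last exact: initial_continuous.
  apply: continuous_comp; last exact: qc.
  exact: (@cvg_pair R R (natural A) (nbhs (0 : R)) (nbhs (0 : R))
    (nbhs ((1 : A) : natural A)) _ _ _ idfun (fun=> (1 : A) : natural A)
    cvg_id (cvg_cst _)).
have fc t : f t = c t - t ^+ 2 * coord (vbasis {:A}) i (q x) - c 0.
  rewrite /f /c /polar !linearB/= scale0r scale0r add0r qM.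
  rewrite mulr_algl linearZ_LR/= (star1 starP) -scalerAr mulr1 scalerA.
  by rewrite !linearZ_LR.
move: c0 => /cvgrPdist_lt/(_ 1 ltr01) /nbhs_ballP[d /= d0 dc].
apply: (@additive_bounded_linear _ _ d
  (1 + d ^+ 2 * `|coord (vbasis {:A}) i (q x)|)) => //.
  by move=> t s; rewrite /f scalerDl scalerDl polarDl linearD.
move=> t td; rewrite fc.
have ct : `|c 0 - c t| < 1 by apply: dc; rewrite /ball/= sub0r normrN.
rewrite (_ : _ - c 0 =
  - (c 0 - c t) - t ^+ 2 * coord (vbasis {:A}) i (q x)); last lra.
apply: le_trans (ler_normB _ _) _; rewrite normrN lerD//; first exact: ltW.
rewrite normrM ler_wpM2r// normrX lerXn2r// ?nnegrE// ltW//.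
Qed.

Lemma polar_star x y : star (polar x y) = polar x y.
Proof. by have [qs _ _] := quadq; rewrite /polar !linearB/= -!qs. Qed.

Lemma polarM (a : A) x y : polar (a *: x) (a *: y) = a * polar x y * star a.
Proof.
have [_ qM _] := quadq.
by rewrite /polar -scalerDr !qM !mulrBr !mulrBl.
Qed.

Lemma polarxx x : polar x x = 2 *: q x.
Proof.
have q0 : q 0 = 0.
  have := qpar 0 0; rewrite subr0 addr0 => E.
  by apply: linear_ext => f; move/(congr1 f): E;
     rewrite linearZ_LR linearD linear0/= /GRing.scale/=; lra.
have := qpar x x; rewrite subrr q0 addr0 /polar => ->.
apply: linear_ext => f; rewrite !(linearD, linearN, linearZ_LR)/=.
by rewrite /GRing.scale/=; lra.
Qed.

Lemma polar_bilin x y : bilin (fun a b : A => polar (a *: x) (b *: y)).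
Proof.
have scaleE (k : R) (a : A) (z : X) : (k *: a) *: z = k%:A *: (a *: z).
  by rewrite scalerA mulr_algl.
split=> [b k a a'|a k b b'].
  by rewrite scalerDl scaleE polarDl polar_real.
by rewrite scalerDl scaleE polarDr polarC polar_real polarC.
Qed.
End Quadrance.

(** * Hermitian forms *)

Section HermitianForms.
Variables (R : realType) (A : falgType R) (star : {linear A -> A}).
Variables (X : lmodType A) (Q : X -> X -> A).
Hypothesis QP : hermitian_form star Q.

Lemma hermitian_addr x y z : Q x (y + z) = Q x y + Q x z.
Proof. by have [QD _ Qs] := QP; rewrite -Qs QD linearD/= !Qs. Qed.

Lemma polar_hermitian (q : X -> A) x y : (forall x, q x = Q x x) ->
  polar q x y = Q x y + star (Q x y).
Proof.
move=> qQ; have [QD _ Qs] := QP.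
rewrite /polar !qQ !QD !hermitian_addr Qs.
by apply: linear_ext => f; rewrite !(linearD, linearN)/=; lra.
Qed.

Lemma hermitian_parallelogram x y :
  Q (x + y) (x + y) + Q (x - y) (x - y) = 2 *: (Q x x + Q y y).
Proof.
have [QD QZ Qs] := QP.
have QN u v : Q (- u) v = - Q u v by rewrite -scaleN1r QZ mulN1r.
have QNr u v : Q u (- v) = - Q u v by rewrite -Qs QN linearN/= Qs.
rewrite !QD !hermitian_addr !QN !QNr.
apply: linear_ext => f; rewrite !(linearD, linearN, linearZ_LR)/=.
by rewrite /GRing.scale/=; lra.
Qed.
End HermitianForms.

(** The solutions Q(x,y) of equation (1) of the introduction fit together into a
    Hermitian form, each axiom following from their uniqueness. *)
Lemma exists_hermitian_form (R : realType) (A : falgType R)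
    (star : {linear A -> A}) (X : lmodType A) (q : X -> A) :
  star_involution star -> polarizable star -> quadrance star q ->
  (forall x y, q (x + y) + q (x - y) = 2 *: (q x + q y)) ->
  exists Q : X -> X -> A, hermitian_form star Q /\ (forall x, q x = Q x x).
Proof.
move=> starP polA quadq qpar.
have [B0 B0P] := exists_star_product starP polA.
have [B [e [BP Bstar eP e1]]] := exists_trace_frame starP B0P.
have ex x y : exists Q, forall a : A,
    polar q (a *: x) y = a * Q + star Q * star a.
  have [] := @re_scale_exists _ _ _ starP _ _ BP Bstar eP e1 _
    (polar_bilin starP quadq qpar x y).
  - by move=> a b; exact: polar_star.
  - by move=> c a b; rewrite -!scalerA (polarM quadq).
  by move=> Q QE; exists Q => a; rewrite -QE scale1r.
pose Q x y := sval (cid (ex x y)).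
have QE x y a : polar q (a *: x) y = a * Q x y + star (Q x y) * star a.
  exact: (svalP (cid (ex x y)) a).
have Quniq x y D : (forall a, polar q (a *: x) y = a * D + star D * star a) ->
    Q x y = D.
  move=> DE; apply/eqP; rewrite -subr_eq0; apply/eqP.
  apply: (re_scale_inj starP BP) => a.
  by rewrite linearB/= mulrBr mulrBl addrACA -QE DE -opprD subrr.
have starM := starP.1; have starK := starP.2.
have Qs x y : star (Q x y) = Q y x.
  apply/esym/Quniq => a; rewrite starK.
  have QE1 : polar q x y = Q x y + star (Q x y).
    by have := QE x y 1; rewrite scale1r mul1r star1// mulr1.
  (* Polarisation of q(ax) = a q(x) a^* in the pair a, 1 turns H(ax, y) into
     H(x, ay). *)
  have := polarM quadq (a + 1) x y.
  rewrite [polar q (a *: y) x]polarC.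
  rewrite !scalerDl !scale1r (polarDl qpar) !(polarDr qpar) (polarM quadq).
  rewrite QE QE1 linearD star1//= !(mulrDl, mulrDr) !(mul1r, mulr1) => E.
  by apply: linear_ext => f; move/(congr1 f): E; rewrite !linearD/=; lra.
exists Q; split; first split.
- move=> x y z; apply: Quniq => a.
  by rewrite scalerDr polarDl// !QE linearD/= mulrDr mulrDl addrACA.
- move=> a x y; apply: Quniq => b.
  by rewrite scalerA QE !starM !mulrA.
- exact: Qs.
- move=> x; have := QE x x 1.
  rewrite scale1r polarxx// mul1r star1// mulr1 Qs.
  move=> E; apply: linear_ext => f; move/(congr1 f): E.
  by rewrite linearZ_LR linearD/= /GRing.scale/=; lra.
Qed.

Theorem theorem1p3 (R : realType) (A : falgType R) (star : {linear A -> A})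
  (starP : star_involution star) (polA : polarizable star)
  (X : lmodType A) (q : X -> A) (quadq : quadrance star q) :
  ((exists Q : X -> X -> A,
      hermitian_form star Q /\ (forall x, q x = Q x x)) <->
   (forall x y, q (x + y) + q (x - y) = 2 *: (q x + q y)))
  /\
  (forall Q Q' : X -> X -> A,
     hermitian_form star Q -> (forall x, q x = Q x x) ->
     hermitian_form star Q' -> (forall x, q x = Q' x x) ->
     forall x y, Q x y = Q' x y).
Proof.
split; first split.
- by move=> [Q [QP qQ]] x y; rewrite !qQ; exact: hermitian_parallelogram QP _ _.
- exact: exists_hermitian_form.
move=> Q Q' QP qQ QP' qQ' x y; apply/eqP; rewrite -subr_eq0; apply/eqP.
have [B0 B0P] := exists_star_product starP polA.
have [_ QZ _] := QP; have [_ QZ' _] := QP'.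
apply: (re_scale_inj starP B0P) => a.
rewrite -starP.1 mulrBr -QZ -QZ' linearB/= addrACA.
rewrite -(polar_hermitian QP _ _ qQ) -opprD -(polar_hermitian QP' _ _ qQ').
by rewrite subrr.
Qed.
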